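(* Let $G$ be a connected graph, $\sigma$ a signature of $G$, and $t \in \{0,\dots,\chi(G)\}$. If $\Delta(G) - t$ is odd, then $\chi^t_{sym}(G,\sigma) \leq \Delta(G) + 1$. If $\Delta(G) - t$ is even, then $\chi^t_{sym}(G,\sigma) = \Delta(G) + 2$ or $\chi^t_{sym}(G,\sigma) \leq \Delta(G)$. Furthermore (in this case of $\Delta(G)-t$ even), $\chi^t_{sym}(G,\sigma) = \Delta(G) + 2$ if and only if one of the following holds: (1) $G$ is a complete graph and $t = \chi(G)-1\ (= \Delta(G))$; (2) $(G,\sigma)$ is a balanced complete graph; (3) $(G,\sigma)$ is a balanced odd circuit; (4) $(G,\sigma)$ is an unbalanced even circuit and $t=0$; (5) $(G,\sigma)$ is an unbalanced odd circuit and $t=2$.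
   Context: Graphs are finite multigraphs without loops; $\chi(G)$ and $\Delta(G)$ denote the chromatic number and the maximum degree of $G$. A signed graph $(G,\sigma)$ is a graph $G$ with a signature $\sigma:E(G)\to\{+,-\}$. A circuit is a connected 2-regular graph; it is odd/even according to its length; it is positive if the product of the signs of its edges is $+$, and negative otherwise. A signed graph is balanced if all its circuits are positive, and unbalanced otherwise. A symmetric set is a set $S$ with an involution $s\mapsto -s$ on $S$; $s$ is self-inverse if $s=-s$. $S_{2k}^t$ ($t,k\ge 0$) is the symmetric set with exactly $t$ self-inverse elements $0_1,\dots,0_t$ and $2k$ non-self-inverse elements $\pm s_1,\dots,\pm s_k$. A proper $S_{2k}^t$-coloring of $(G,\sigma)$ is a map $c:V(G)\to S_{2k}^t$ with $c(v)\ne\sigma(e)c(w)$ for every edge $e=vw$. For $t\in\{0,\dots,\chi(G)\}$, the symset $t$-chromatic number $\chi_{sym}^t(G,\sigma)$ is the minimum of $t+2k$ over all $k\ge0$ for which $(G,\sigma)$ has a proper $S_{2k}^t$-coloring.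
   Formalization: The equivalence is stated except when t = 0 and (G,σ) arises from a simple complete graph on at least 3 vertices or a simple odd circuit by replacing each edge by a positive and a negative parallel edge; there χ_sym = Δ+2 but none of (1)–(5) holds. *)

(* Defs.v *)
From HB Require Import structures.
From mathcomp Require Import all_boot all_order all_algebra.

Set Implicit Arguments.
Unset Strict Implicit.
Unset Printing Implicit Defensive.

Import GRing.Theory.

(* Finite loopless multigraphs: the ends of an edge form a 2-element set, and
   distinct edges may have the same ends. *)
Record mgraph := MGraph {
  vert : finType;
  edge : finType;
  ends : edge -> {set vert};
  card_ends : forall e, #|ends e| = 2
}.

Section Graph.
Variable G : mgraph.

(* A pair (W, C) with [subgraph W C] is the subgraph of G with vertex set W and
   edge set C; G itself is (setT, setT). *)
Definition subgraph (W : {set vert G}) (C : {set edge G}) :=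
  [forall e in C, ends e \subset W].

Definition adj_in (C : {set edge G}) : rel (vert G) :=
  fun u v => [exists e in C, ends e == [set u; v]].

Definition deg_in (C : {set edge G}) (v : vert G) : nat :=
  #|[set e in C | v \in ends e]|.

(* The null graph is not connected. *)
Definition connected_in (W : {set vert G}) (C : {set edge G}) :=
  (W != set0) && [forall u in W, forall v in W, connect (adj_in C) u v].

(* The length of the circuit (W, C) is #|C|; circuits of length 2 (two parallel
   edges) are allowed. *)
Definition circuit_in (W : {set vert G}) (C : {set edge G}) :=
  [&& subgraph W C, connected_in W C & [forall v in W, deg_in C v == 2]].

Definition connected := connected_in setT setT.
Definition circuit := circuit_in setT setT.
Definition glength := #|[set: edge G]|.

(* Every two distinct vertices are joined by exactly one edge. *)
Definition complete :=
  [forall u : vert G, forall v : vert G,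
    (u != v) ==> (#|[set e : edge G | ends e == [set u; v]]| == 1)].

Definition maxdeg : nat := \max_(v : vert G) deg_in setT v.

Definition colorable (n : nat) :=
  [exists c : {ffun vert G -> 'I_n},
    [forall e : edge G, forall v : vert G, forall w : vert G,
      (ends e == [set v; w]) ==> (c v != c w)]].

Lemma ends_neq (e : edge G) (v w : vert G) : ends e == [set v; w] -> v != w.
Proof. by move=> /eqP ee; have := card_ends e; rewrite ee cards2; case: eqP. Qed.

Lemma colorable_exists : exists n, colorable n.
Proof.
exists #|vert G|; apply/existsP; exists [ffun v => enum_rank v].
apply/forallP => e; apply/forallP => v; apply/forallP => w.
apply/implyP => /ends_neq; rewrite !ffunE.
by apply: contra => /eqP /enum_rank_inj ->.
Qed.

Definition chi : nat := ex_minn colorable_exists.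

End Graph.

(* [S_{2k}^t]: [inl i] is the self-inverse element 0_i, and [inr (j, b)] is
   s_j or -s_j according to the value of b. *)
Definition symset (t k : nat) : finType := ('I_t + 'I_k * bool)%type.

Definition symopp (t k : nat) (s : symset t k) : symset t k :=
  match s with
  | inl i => inl i
  | inr (j, b) => inr (j, ~~ b)
  end.

Section SignedGraph.
Variables (G : mgraph) (sigma : edge G -> bool).

(* In a signature, [sigma e = true] means that e is negative, so that the sign
   of e is the integer (-1) ^+ sigma e. *)
Definition symact (t k : nat) (b : bool) (s : symset t k) : symset t k :=
  if b then symopp s else s.

Definition positive (C : {set edge G}) :=
  (\prod_(e in C) (-1) ^+ sigma e == 1 :> int)%R.

Definition balanced :=
  [forall W : {set vert G}, forall C : {set edge G},
    circuit_in W C ==> positive C].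

Definition sym_proper (t k : nat) (c : {ffun vert G -> symset t k}) :=
  [forall e : edge G, forall v : vert G, forall w : vert G,
    (ends e == [set v; w]) ==> (c v != symact (sigma e) (c w))].

Definition sym_colorable (t k : nat) :=
  [exists c : {ffun vert G -> symset t k}, sym_proper c].

(* The k with n = t + 2 k are automatically at most n. *)
Definition sym_size (t n : nat) :=
  [exists k : 'I_n.+1, (n == t + 2 * k) && sym_colorable t k].

Lemma sym_size_exists (t : nat) : exists n, sym_size t n.
Proof.
have lt_k : #|vert G| < (t + 2 * #|vert G|).+1.
  by rewrite ltnS mulSn mul1n addnA leq_addl.
exists (t + 2 * #|vert G|); apply/existsP; exists (Ordinal lt_k).
rewrite eqxx /=; apply/existsP.
exists [ffun v => inr (enum_rank v, true)].
apply/forallP => e; apply/forallP => v; apply/forallP => w.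
apply/implyP => /ends_neq; rewrite !ffunE; apply: contra => /eqP.
by rewrite /symact; case: (sigma e) => //= -[/enum_rank_inj ->].
Qed.

Definition chi_sym (t : nat) : nat := ex_minn (sym_size_exists t).

(* (G, sigma) arises from a simple graph H by replacing each edge of H by two
   parallel edges of opposite signs, where H is a complete graph on at least 3
   vertices or an odd circuit.  Then properness of c only says that
   c v <> c w and c v <> - c w whenever v and w are adjacent in H, so that
   chi_sym 0 = 2 * chi H = 2 * (maxdeg H + 1) = maxdeg G + 2. *)
Definition doubled_brooks :=
  [&& 2 < #|vert G|,
      [forall u : vert G, forall v : vert G, adj_in setT u v ==>
        [forall b : bool,
          #|[set e : edge G | (ends e == [set u; v]) && (sigma e == b)]| == 1]]
    & [forall u : vert G, forall v : vert G, (u != v) ==> adj_in setT u v]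
      || odd #|vert G| && [forall v : vert G, #|[set u | adj_in setT v u]| == 2]].

End SignedGraph.

(* Main.v *)
Require Import Defs.
From mathcomp Require Import all_boot all_order all_algebra.
From mathcomp Require Import zify.

(* With t + 2k > Delta colours, a greedy colouring exists; hence, when
   Delta - t is even, it remains to decide when t + 2k = Delta colours fail.  If they
   do, the pairs (sign, neighbour) at each vertex number exactly Delta.
   Colouring a cycle last, as in Zajac's proof of Brooks' theorem, shows that
   every path extends to a Hamiltonian cycle.  Lovasz' argument (two
   non-adjacent neighbours of v forbid the same colour at v, which is coloured
   last) then leaves only complete graphs and cycles as underlying simple
   graphs.  A double edge is harmless if t > 0, since a colour 0_i forbids only
   one colour across it; if k > 0, the ends of a single edge in a triangle can
   be coloured so that the third vertex sees a repetition, unless the triangle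
   is positive without double edges.  The case Delta = 2 is settled by summing, over all edges, the
   signs and the colours of the ends: every vertex is counted twice. *)

Set Implicit Arguments.
Unset Strict Implicit.
Unset Printing Implicit Defensive.

(** * Colourings with a repeated forbidden colour *)

Section Greedy.
Variables (V S : finType) (act : bool -> S -> S) (E : bool -> rel V).
Hypothesis actK : forall b, involutive (act b).
Hypothesis E_sym : forall b, symmetric (E b).
Hypothesis E_irr : forall b, irreflexive (E b).

Implicit Types (A B C U X : {set V}) (c : V -> S).

(** These are the constraints at [u] from [B]: a neighbour joined by both signs counts twice,
    parallel edges of equal sign count once. *)
Definition nb (u : V) (B : {set V}) : {set bool * V} :=
  [set p | E p.1 u p.2 && (p.2 \in B)].

Definition proper_on (B : {set V}) (c : V -> S) :=
  forall b u v, u \in B -> v \in B -> E b u v -> c u != act b (c v).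

Definition forbidden (c : V -> S) u B := [set act p.1 (c p.2) | p in nb u B].

Definition adj : rel V := fun u v => E true u v || E false u v.

Lemma adj_sym : symmetric adj.
Proof. by move=> u v; rewrite /adj !(E_sym _ u). Qed.

Lemma adj_irr : irreflexive adj.
Proof. by move=> u; rewrite /adj !E_irr. Qed.

Lemma adjP u v : reflect (exists b, E b u v) (adj u v).
Proof.
apply: (iffP orP) => [[] Euv|[[] Euv]]; [by exists true | by exists false | |];
  by [left|right].
Qed.

Lemma nbS u (B C : {set V}) : B \subset C -> nb u B \subset nb u C.
Proof.
by move=> sBC; apply/subsetP=> p; rewrite !inE => /andP[-> /(subsetP sBC)].
Qed.

Lemma nb_lt u B y : adj u y -> y \notin B -> #|nb u B| < #|nb u setT|.
Proof.
case/adjP=> b Euy yB; apply: proper_card; rewrite properEneq nbS ?subsetT //.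
rewrite andbT; apply: contraNneq yB => eqN.
have: (b, y) \in nb u setT by rewrite !inE Euy.
by rewrite -eqN inE => /andP[].
Qed.

Lemma extend_vertex B c u :
    proper_on B c -> #|forbidden c u B| < #|S| ->
  exists2 c', proper_on (u |: B) c' & forall v, v != u -> c' v = c v.
Proof.
move=> Bc ltS; have [s sF]: exists s, s \notin forbidden c u B.
  apply/existsP; rewrite -negb_forall; apply: contraL ltS => /forallP allF.
  by rewrite -leqNgt subset_leq_card //; apply/subsetP=> s _; apply: allF.
exists (fun v => if v == u then s else c v) => [b x y|v /negPf-> //].
have sN z e : z \in B -> E e u z -> s != act e (c z).
  move=> zB Euz; apply: contraNneq sF => ->.
  by apply/imsetP; exists (e, z); rewrite // inE Euz.
rewrite !in_setU1; case: (x =P u) => [->|_] /=; case: (y =P u) => [->|_] /=.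
- by rewrite E_irr.
- by move=> _; apply: sN.
- move=> xB _ Exu; rewrite -(inj_eq (inv_inj (actK b))) actK eq_sym.
  by apply: sN; rewrite // E_sym.
- exact: Bc.
Qed.

(** A degeneracy argument, with [U] collecting the vertices set aside. Outside [A :|: U], a vertex
    with fewer than [#|S|] constraints joins [U]; once the others are coloured by induction, it
    still has a free colour. *)
Lemma greedy A U c :
    [disjoint A & U] -> proper_on A c ->
    (forall X : {set V}, X != set0 -> [disjoint X & A :|: U] ->
       exists2 x, x \in X & #|nb x (A :|: X)| < #|S|) ->
  exists2 c', proper_on (~: U) c' & {in A, c' =1 c}.
Proof.
have [n] := ubnP #|~: (A :|: U)|; elim: n U => // n IHn U ltn dAU Ac cutP.
have [eq0|nz] := eqVneq (~: (A :|: U)) set0.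
  exists c => //; suff <-: A = ~: U by [].
  apply/setP=> x; have /setP/(_ x) := eq0; rewrite !inE.
  case xA: (x \in A) => /=; last by case: (x \in U).
  by rewrite (disjointFr dAU xA).
have [|x xX ltx] := cutP _ nz; first by rewrite -setI_eq0 setIC setICr.
move: (xX); rewrite !inE negb_or => /andP[xA xU].
have [||||c' c'P c'A] := IHn (x |: U).
- rewrite -ltnS; apply: leq_trans ltn; rewrite ltnS; apply: proper_card.
  rewrite properC; apply/properP; split; first by rewrite setUS // subsetUr.
  by exists x; rewrite !inE ?eqxx ?orbT // negb_or xA.
- rewrite disjoint_sym disjoints_subset subUset sub1set inE xA.
  by rewrite -disjoints_subset disjoint_sym.
- by [].
- move=> X nzX dX; apply: cutP => //; apply: disjointWr dX.
  by rewrite setUS // subsetUr.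
have xn : x \notin A by [].
have [|c2 c2P c2E] := extend_vertex (u := x) c'P.
  apply: leq_ltn_trans (leq_imset_card _ _) _; apply: leq_ltn_trans ltx.
  apply: subset_leq_card; apply: nbS; apply/subsetP=> y; rewrite !inE.
  by case: (y \in A) => //=; rewrite negb_or => /andP[].
exists c2 => [|y yA]; last by rewrite c2E ?c'A //; apply: contraNneq xA => <-.
suff <-: x |: ~: (x |: U) = ~: U by [].
by apply/setP=> y; rewrite !inE; case: (y =P x) => [->|]//=; rewrite xU.
Qed.

Lemma greedy_all : 0 < #|S| -> (forall u, #|nb u setT| < #|S|) ->
  exists c, proper_on setT c.
Proof.
move=> S_gt0 ltS; have [s0 _]: exists s0 : S, s0 \in setT.
  by apply/set0Pn; rewrite -card_gt0 cardsT.
have [||X /set0Pn[x xX] _|c cP _] := @greedy set0 set0 (fun=> s0).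
- by rewrite -setI_eq0 set0I.
- by move=> b x y; rewrite inE.
- by exists x => //; exact: leq_ltn_trans (subset_leq_card (nbS x (subsetT _))) (ltS x).
by exists c; rewrite setC0 in cP.
Qed.

(** All vertices but [r] are coloured first: an edge from [X] to the outside of [A :|: X] saves one
    constraint. At [r], the constraints [p] and [q] forbid the same colour, so fewer than [#|S|]
    colours are forbidden. *)
Lemma greedy_save A c r p q :
    proper_on A c -> (forall u, #|nb u setT| <= #|S|) ->
    (forall X : {set V}, X != set0 -> [disjoint X & r |: A] ->
       exists x y, [/\ x \in X, adj x y & y \notin A :|: X]) ->
    r \notin A -> p \in nb r A -> q \in nb r A -> p != q ->
    act p.1 (c p.2) = act q.1 (c q.2) ->
  exists c', proper_on setT c'.
Proof.
move=> Ac degS cutP rA pA qA npq eq_act.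
have [|//||c' c'P c'A] := greedy (A := A) (U := [set r]) (c := c).
- by rewrite disjoint_sym disjoints1.
- move=> X nzX dX; have [|x [y [xX xy yAX]]] := cutP X nzX.
    by rewrite setUC.
  by exists x => //; apply: leq_trans (degS x); apply: nb_lt xy yAX.
have [|c2 c2P _] := extend_vertex (u := r) c'P.
  apply: leq_trans (degS r).
  apply: leq_trans (subset_leq_card (nbS _ (subsetT (~: [set r])))).
  rewrite ltn_neqAle leq_imset_card andbT; apply: contra npq => /imset_injP inj.
  have sub z : z \in nb r A -> z \in nb r (~: [set r]).
    rewrite !inE => /andP[-> zA]; apply: contraNneq rA => <- //.
  apply/eqP/inj; rewrite ?sub //; move: pA qA; rewrite !inE.
  by move=> /andP[_ pA] /andP[_ qA]; rewrite !c'A.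
by exists c2; move: c2P; rewrite setUCr.
Qed.

(** * Structure of uncolourable graphs with at most [#|S|] constraints at each vertex *)

Hypothesis nb_le : forall u, #|nb u setT| <= #|S|.
Hypothesis cut : forall X : {set V}, X != set0 -> X != setT ->
  exists x y, [/\ x \in X, y \notin X & adj x y].
Hypothesis uncolorable : ~ exists c, proper_on setT c.

Lemma path_cross a s X :
    path adj a s -> has (mem X) (a :: s) -> ~~ all (mem X) (a :: s) ->
  exists x y, [/\ x \in X, adj x y, y \in a :: s & y \notin X].
Proof.
elim: s a => [|b s IHs] a /=; first by case: (a \in X).
case/andP=> ab bs; have [aX|aX] /= := boolP (a \in X); last first.
  move=> hasX _; have [bX|bX] := boolP (b \in X).
    by exists b, a; split; rewrite ?mem_head // adj_sym.
  have [//||x [y [xX xy yS yX]]] := IHs _ bs; first by rewrite /= (negPf bX).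
  by exists x, y; split=> //; rewrite inE yS orbT.
move=> _ allX; have [bX|bX] := boolP (b \in X).
  have [|//|x [y [xX xy yS yX]]] := IHs _ bs; first by rewrite /= bX.
  by exists x, y; split=> //; rewrite inE yS orbT.
by exists a, b; split=> //; rewrite !inE eqxx orbT.
Qed.

(** Supplies the exit condition of [greedy_save] when the vertices outside [A] form a path: a
    nonempty set of them missing [r] is left along an edge of the path. *)
Lemma path_cut A r a s :
    path adj a s -> (forall v, (v \in a :: s) = (v \notin A)) -> r \notin A ->
  forall X, X != set0 -> [disjoint X & r |: A] ->
  exists x y, [/\ x \in X, adj x y & y \notin A :|: X].
Proof.
move=> pas memA rA X /set0Pn[x0 x0X] dX.
have xA x : x \in X -> x \notin A.
  by move/(disjointFr dX); rewrite !inE => /norP[].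
have [|||x [y [xX xy ys yX]]] := @path_cross a s X.
- by [].
- by apply/hasP; exists x0; rewrite ?memA ?xA.
- apply/allPn; exists r; rewrite ?memA //; apply/negP=> /(disjointFr dX).
  by rewrite !inE eqxx.
by exists x, y; split; rewrite // inE negb_or -memA ys.
Qed.

(** A vertex [u] with fewer constraints could be coloured last: every proper nonempty set is left by
    some edge, and the set of all vertices contains [u]. *)
Lemma nb_regular u : #|nb u setT| = #|S|.
Proof.
apply/eqP; rewrite eqn_leq nb_le leqNgt; apply/negP => ltu.
case: (pickP (mem [set: S])) => [s0 _|S0]; last first.
  by move: ltu; rewrite -cardsT (eq_card0 S0).
have [|//||c cP _] := greedy (A := set0) (U := set0) (c := fun=> s0).
- by rewrite -setI_eq0 set0I.
- by move=> b x y; rewrite inE.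
- move=> X nzX _; rewrite set0U.
  have [->|XT] := eqVneq X setT; first by exists u; rewrite ?inE.
  have [x [y [xX yX xy]]] := cut nzX XT.
  by exists x; rewrite // (leq_trans (nb_lt xy yX)).
by apply: uncolorable; exists c; rewrite setC0 in cP.
Qed.

Lemma has_split_last (T : Type) (a : pred T) (s : seq T) :
  has a s -> exists s1 x s2, [/\ s = s1 ++ x :: s2, a x & ~~ has a s2].
Proof.
elim: s => //= x s IHs; case: (boolP (has a s)) => [/IHs|ns].
  by case=> s1 [y [s2 [-> ay s2n]]] _; exists (x :: s1), y, s2.
by rewrite orbF => ax; exists [::], x, s.
Qed.

(* A vertex [u] of the cycle followed by one without outside neighbours can be
   coloured last: its successor can repeat, at [u], an outside neighbour of [u]. *)
Lemma cycle_spanning w s :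
    cycle adj s -> uniq s -> w \in s -> {in predC (mem s), forall z, ~~ adj w z} ->
  forall v, v \in s.
Proof.
move=> cs us ws wN; have [sT|] := eqVneq [set v in s] setT.
  by move=> v; have := in_setT v; rewrite -sT inE.
move=> sNT; exfalso.
pose Q : pred V := fun u => [exists z, (z \notin s) && adj u z].
have wQ : ~~ Q w.
  by apply/existsP=> -[z /andP[zs wz]]; have := wN z zs; rewrite wz.
have [i s' def_s] := rot_to ws.
have hasQ : has Q s'.
  have [|x [y []]] := cut _ sNT.
    by apply/set0Pn; exists w; rewrite inE.
  rewrite !inE => xs ys xy; have Qx : Q x by apply/existsP; exists y; rewrite ys.
  apply/hasP; exists x => //; move: xs; rewrite -(mem_rot i s) def_s inE.
  by case/predU1P=> // eqx; rewrite -eqx Qx in wQ.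
(* With [u] the last vertex after [w] satisfying [Q], its cyclic successor [x] has no neighbour off
   the cycle; if [u] ends the sequence, [x] is [w]. *)
have [s1 [u [s2 [def_s' Qu s2Q]]]] := has_split_last hasQ.
have [x [p [eq_p xQ lastp]]] : exists x p,
    [/\ rot (size (w :: s1 ++ [:: u])) (rot i s) = x :: p, ~~ Q x
      & last x p = u].
  have ->: rot i s = (w :: s1 ++ [:: u]) ++ s2 by rewrite def_s def_s' /= -catA.
  rewrite rot_size_cat; case: s2 s2Q {def_s'} => [|x s2] /=.
    by exists w, (s1 ++ [:: u]); rewrite cats1 last_rcons.
  rewrite negb_or => /andP[xQ _]; exists x, (s2 ++ w :: s1 ++ [:: u]).
  by rewrite last_cat /= cats1 last_rcons.
have memp z : (z \in x :: p) = (z \in s) by rewrite -eq_p !mem_rot.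
have {us} : uniq (x :: p) by rewrite -eq_p !rot_uniq.
have {cs} : cycle adj (x :: p) by rewrite -eq_p !rot_cycle.
case: p => [|y p] in eq_p lastp memp *.
  by move=> _ _; move: lastp xQ => /= ->; rewrite Qu.
rewrite [last _ _]/= in lastp; rewrite /= rcons_path lastp.
case/and3P=> _ yp ux /and3P[xyp _ _].
have up_in : u \in y :: p by rewrite -lastp mem_last.
case/existsP: Qu => z /andP[zs uz].
have [bx Eux] := adjP _ _ ux; have [bz Euz] := adjP _ _ uz.
have [s0 _] : exists s0 : S, true.
  have: 0 < #|S|.
    by rewrite -(nb_regular u) card_gt0; apply/set0Pn; exists (bx, x); rewrite !inE Eux.
  by rewrite -cardsT card_gt0 => /set0Pn[s0 _]; exists s0.
pose C := [set v | v \in s].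
have [|||c cP _] := @greedy set0 C (fun=> s0).
- by rewrite -setI_eq0 set0I.
- by move=> b ? ?; rewrite inE.
- move=> X nzX; rewrite !set0U => dX.
  have [|a [b [aX bX ab]]] := cut nzX.
    apply: contraTneq dX => ->; rewrite -setI_eq0 setTI; apply/set0Pn.
    by exists w; rewrite inE.
  by exists a => //; apply: leq_trans (nb_le a); apply: nb_lt ab bX.
have xC : x \in s by rewrite -memp mem_head.
(* Having no neighbour off the cycle, [x] may take any colour; this one forbids at [u], through
   [bx], exactly what [z] forbids through [bz]. *)
pose c1 v := if v == x then act bx (act bz (c z)) else c v.
have zx : z != x by apply: contraNneq zs => ->.
have memA v : (v \in y :: p) = (v \notin x |: ~: C).
  rewrite in_setU1 in_setC in_set negb_or negbK -memp [v \in x :: _]in_cons.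
  by case: eqP => [->|//] /=; apply: negbTE.
apply: uncolorable.
apply: (@greedy_save (x |: ~: C) c1 u (bx, x) (bz, z)) => //.
- have xN b v : v \notin s -> E b x v -> False.
    move=> vs Exv; case/existsP: xQ; exists v; rewrite vs.
    by apply/adjP; exists b.
  move=> b v1 v2; rewrite !inE /c1; have [->|n1] := eqVneq v1 x; last first.
    have [->|n2] := eqVneq v2 x; last by rewrite /= => *; apply: cP; rewrite ?inE.
    by rewrite /= E_sym => v1s _ /xN-/(_ v1s).
  by have [->|n2] := eqVneq v2 x; rewrite ?E_irr //= => _ ? /xN[].
- by apply: (path_cut yp memA); rewrite -memA.
- by rewrite -memA.
- by rewrite !inE Eux eqxx.
- by rewrite !inE Euz zs orbT.
- by rewrite xpair_eqE (eq_sym x) (negPf zx) andbF.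
- by rewrite /c1 /= eqxx (negPf zx) actK.
Qed.

(** Extend the path until its last vertex [l] has all its neighbours on it. If [v] is the first of
    them, the part from [v] to [l] closes to a cycle containing every neighbour of [l]. It spans by
    [cycle_spanning], so [v] is [a]. *)
Lemma hamiltonian a s :
    path adj a s -> uniq (a :: s) -> 1 < #|V| ->
  exists s', [/\ path adj a (s ++ s'), uniq (a :: s ++ s'),
                 forall v, v \in a :: s ++ s' & adj (last a (s ++ s')) a].
Proof.
move=> pas us gtV; have [n] := ubnP (#|V| - size s).
elim: n s pas us => // n IHn s pas us ltn.
pose l := last a s.
have [/existsP[z /andP[zs lz]]|ext] :=
    boolP [exists z, (z \notin a :: s) && adj l z].
  have [|||s' [p' u' c' l']] := IHn (rcons s z).
  - by rewrite rcons_path pas.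
  - by rewrite -rcons_cons rcons_uniq zs.
  - have: uniq (rcons (a :: s) z) by rewrite rcons_uniq zs.
    move/card_uniqP=> sz; have := max_card (mem (rcons (a :: s) z)).
    by rewrite sz /= size_rcons => lesz; move: ltn lesz; move: (size s) #|V| => p q; lia.
  by exists (z :: s'); rewrite -cat_rcons.
exists [::]; rewrite cats0.
have lN z : adj l z -> z \in a :: s.
  by move=> lz; apply: contraNT ext => zs; apply/existsP; exists z; rewrite zs.
have hasl: has (adj l) (a :: s).
  have [||x [y []]] := @cut [set l].
  - by apply/set0Pn; exists l; rewrite inE.
  - by apply: contraTneq gtV => lT; rewrite -cardsT -lT cards1.
  by rewrite !inE => /eqP-> yl ly; apply/hasP; exists y; rewrite ?lN.
have [v [s1 [s2 [def_as lv s1N]]]] : exists v s1 s2,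
    [/\ a :: s = s1 ++ v :: s2, adj l v & ~~ has (adj l) s1].
  move: hasl; rewrite /l => /(split_find_nth a); move: (a :: s) => r.
  by case=> v s1 s2 lv s1N; exists v, s1, s2; rewrite -cat_rcons.
have lastv : last v s2 = l.
  by have := congr1 (last a) def_as; rewrite last_cat.
have pv : path adj v s2.
  case: s1 def_as {s1N} => [[<- <-] //|b s1 [_ def_s]].
  by move: pas; rewrite def_s cat_path /= => /and3P[].
have /and3P[us1 s1v us2] : [&& uniq s1, ~~ has (mem s1) (v :: s2) & uniq (v :: s2)].
  by rewrite -cat_uniq -def_as.
have spans z : z \in v :: s2.
  apply: (@cycle_spanning l) => //.
  - by rewrite /= rcons_path pv lastv.
  - by rewrite -lastv mem_last.
  - move=> y ys2; apply/negP=> ly; have := lN _ ly.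
    rewrite def_as mem_cat (negPf (ys2 : y \notin v :: s2)) orbF => ys1.
    by case/hasP: s1N; exists y.
case: s1 def_as s1v {us1 s1N} => [[-> ->] _|b s1 _]; last first.
  by move/hasPn/(_ b (spans b)); rewrite /= mem_head.
by split=> //; rewrite lastv.
Qed.

(** Deleting [a] from a Hamiltonian cycle leaves a path on the other vertices. With [s0] at [a],
    both edges to [v] forbid the same colour, and [v] can be coloured last. *)
Lemma fixed_color_single s0 a v :
  act true s0 = act false s0 -> E true v a -> E false v a -> False.
Proof.
move=> fix_s0 Eta Efa; have va : v != a by apply: contraTneq Eta => ->; rewrite E_irr.
have gtV : 1 < #|V|.
  by rewrite -cardsT (cardD1 v) (cardD1 a) !inE eq_sym va.
have [//|//|//|[|b s] [/= pas us spans _]] := @hamiltonian a [::].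
  by have := spans v; rewrite inE (negPf va).
case/andP: pas us => _ bs /andP[a_bs us].
have memA z : (z \in b :: s) = (z \notin [set a]).
  have := spans z; rewrite in_set1 [z \in a :: _]in_cons.
  by case: eqP => [-> _|//] /=; apply: negbTE.
apply: uncolorable.
apply: (@greedy_save [set a] (fun=> s0) v (true, a) (false, a)) => //.
- by move=> e x y /set1P-> /set1P->; rewrite E_irr.
- by apply: (path_cut bs memA); rewrite inE.
- by rewrite inE.
- by rewrite !inE Eta eqxx.
- by rewrite !inE Efa eqxx.
Qed.

(* Lovasz' colouring: [x] and [y] forbid the same colour at [v], coloured last. *)
Lemma induced_path_deg x v y w :
  x != y -> adj v x -> adj v y -> ~~ adj x y -> adj v w -> (w == x) || (w == y).
Proof.
move=> xy vx vy nxy vw; apply/norP=> -[wx wy].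
have [[bx Ex] [cy Ey]] := (adjP _ _ vx, adjP _ _ vy).
have neq z : adj v z -> v != z by move=> vz; apply: contraTneq vz => ->; rewrite adj_irr.
have gtV : 1 < #|V|.
  by rewrite -cardsT (cardD1 x) (cardD1 y) !inE eq_sym xy.
(* A Hamiltonian cycle starting with [x], [v], [y] leaves a path on all other vertices, [w] among
   them. *)
have [|||s [/= pas us spans _]] := @hamiltonian x [:: v; y].
- by rewrite /= adj_sym vx vy.
- by rewrite /= !inE !negb_or xy (eq_sym x) !neq.
- by [].
case: s pas us spans => [_ _ /(_ w)|b s].
  by rewrite !inE (negPf wx) (negPf wy) eq_sym (negPf (neq _ vw)).
case/and4P=> _ _ _ bs /and4P[xs vs ys us] spans.
pose A := [set x; y].
have memA z : (z \in b :: s) = (z \notin v |: A).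
  apply/idP/idP => [zs|]; rewrite !inE !negb_or.
    apply/and3P; split; apply: contraTneq zs => -> //.
      by move: vs; rewrite in_cons negb_or => /andP[].
    by move: xs; rewrite 2!in_cons !negb_or => /and3P[].
  case/and3P=> zv zx zy; have := spans z.
  by rewrite !inE (negPf zv) (negPf zx) (negPf zy).
have vA : v \notin A by rewrite !inE negb_or !neq.
have [s0 _] : exists s0 : S, true.
  have: 0 < #|S|.
    by rewrite -(nb_regular v) card_gt0; apply/set0Pn; exists (bx, x); rewrite !inE Ex.
  by rewrite -cardsT card_gt0 => /set0Pn[s1 _]; exists s1.
apply: uncolorable.
apply: (@greedy_save A (fun z => if z == x then act bx s0 else act cy s0) v
          (bx, x) (cy, y)) => //.
- have nE b0 : E b0 x y = false.
    by apply: contraNF nxy => Exy; apply/adjP; exists b0.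
  by move=> b0 z1 z2 /set2P[]-> /set2P[]->; rewrite ?E_irr ?nE // E_sym nE.
(* A set containing [w] is left through the edge to [v]; a set avoiding [w] is left along the
   path. *)
- move=> X nzX dX; have [wX|wX] := boolP (w \in X).
    exists w, v; rewrite adj_sym; split=> //; rewrite inE negb_or vA /=.
    by apply/negP=> /(disjointFr dX); rewrite !inE eqxx.
  have [|||a [c [aX ac cX]]] := @path_cut (v |: A) w b s bs memA _ X.
  + by rewrite !inE !negb_or eq_sym neq // wx.
  + exact: nzX.
  + rewrite disjoint_sym disjoints_subset subUset sub1set inE wX.
    by rewrite -disjoints_subset disjoint_sym.
  by exists a, c; split=> //; move: cX; rewrite -setUA inE => /norP[].
- by rewrite !inE Ex eqxx.
- by rewrite !inE Ey eqxx orbT.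
- by rewrite xpair_eqE (negPf xy) andbF.
- by rewrite /= eqxx eq_sym (negPf xy) !actK.
Qed.

(** By [induced_path_deg], a vertex with two non-adjacent neighbours satisfies [P]. If no vertex
    does, every closed neighbourhood is the whole vertex set. Otherwise [P] spreads along edges, by
    means of a Hamiltonian cycle. *)
Lemma complete_or_cycle :
  (forall u v, u != v -> adj u v) \/
  (forall v, exists x y,
     [/\ x != y, [set z | adj v z] = [set x; y] & ~~ adj x y]).
Proof.
pose P v := [exists x, exists y,
  [&& x != y, [set z | adj v z] == [set x; y] & ~~ adj x y]].
have PP v : reflect (exists x y,
    [/\ x != y, [set z | adj v z] = [set x; y] & ~~ adj x y]) (P v).
  apply: (iffP existsP) => [[x /existsP[y /and3P[xy /eqP nv nxy]]]|[x [y [xy nv nxy]]]].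
    by exists x, y.
  by exists x; apply/existsP; exists y; rewrite xy nv eqxx.
have [P0|nzP] := eqVneq [set v | P v] set0.
  left=> u v; pose X := [set z | (z == u) || adj u z].
  have [XT|XT] := eqVneq X setT.
    by have := in_setT v; rewrite -XT inE eq_sym => /orP[->|].
  have [|x [y []]] := cut _ XT.
    by apply/set0Pn; exists u; rewrite inE eqxx.
  rewrite !inE => /orP[/eqP->|ux]; first by move=> /norP[_ /negPf->].
  move=> /norP[yu nuy] xy; have: x \in set0; last by rewrite inE.
  rewrite -P0 inE; apply/PP; exists u, y; split; rewrite 1?eq_sym //.
  apply/setP=> z; rewrite !inE; apply/idP/orP => [xz|[]/eqP->]; rewrite 1?adj_sym //.
    have:= induced_path_deg (x := u) (y := y) (v := x) (w := z).
    by rewrite eq_sym yu adj_sym ux xy nuy xz => /(_ _ _ _ _ _)/orP; apply.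
  by rewrite adj_sym.
right.
have PT : [set v | P v] = setT.
  apply/eqP; apply: contraT => /(cut nzP)[v [y []]]; rewrite !inE.
  case/PP=> x [y' [xy nv nxy]] Py vy; case/negP: Py; apply/PP.
  wlog {y' xy nv nxy} [xy nv nxy] : x / 
     [/\ x != y, [set z | adj v z] = [set x; y] & ~~ adj x y].
    move: vy; have /setP/(_ y) := nv; rewrite !inE => -> /orP[]/eqP eqy; subst y.
      by move/(_ y'); apply; rewrite eq_sym adj_sym setUC.
    by move/(_ x); apply.
  have vx : adj v x by have /setP/(_ x) := nv; rewrite !inE eqxx.
  have neq a b : adj a b -> a != b.
    by move=> ab; apply: contraTneq ab => ->; rewrite adj_irr.
  have gtV : 1 < #|V|.
    by rewrite -cardsT (cardD1 x) (cardD1 y) !inE eq_sym xy.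
  (* The cycle returns to [y] from a vertex [z] other than [v] and [x]; so [v] and [z] are
     non-adjacent neighbours of [y]. *)
  have [|||s [/= pas us spans lasty]] := @hamiltonian y [:: v; x].
  - by rewrite /= vx adj_sym vy.
  - by rewrite /= !inE !negb_or eq_sym neq // eq_sym xy neq.
  - by [].
  pose z := last x s; have yz : adj y z by rewrite adj_sym.
  have zv : z != v.
    have: z \in x :: s by apply: mem_last.
    by apply: contraTneq => ->; case/and3P: us.
  have zx : z != x by apply: contraNneq nxy => <-; rewrite adj_sym.
  have nvz : ~~ adj v z.
    by have /setP/(_ z) := nv; rewrite !inE (negPf zx) eq_sym (negPf (neq _ _ yz)) => ->.
  exists v, z; rewrite eq_sym; split=> //; apply/setP=> w; rewrite !inE.
  apply/idP/idP => [yw|/orP[]/eqP-> //]; last by rewrite adj_sym.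
  by apply: (@induced_path_deg v y z w) => //; rewrite 1?eq_sym 1?adj_sym.
by move=> v; apply/PP; have := in_setT v; rewrite -PT inE.
Qed.

(** Colour [x] and [y] so that both forbid [s0] at [v]. If the three signs did not cancel, this
    would be proper across the single sign [b], and [v], adjacent to every remaining vertex, could
    be coloured last. *)
Lemma single_triangle s0 b b1 b2 v x y :
    (forall e f s, act e (act f s) = act (e (+) f) s) ->
    act true s0 != act false s0 -> (forall u w, u != w -> adj u w) ->
    E b x y -> ~~ E (~~ b) x y -> E b1 v x -> E b2 v y ->
  b = b1 (+) b2.
Proof.
move=> actD s0N compl Exy nExy Ex Ey; apply/eqP/negPn/negP=> neq_b.
have neq e a z : E e a z -> a != z.
  by move=> az; apply: contraTneq az => ->; rewrite E_irr.
have xy := neq _ _ _ Exy.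
have actN e f : e != f -> act e s0 != act f s0.
  by case: e f => -[] //= _; rewrite eq_sym.
apply: uncolorable.
apply: (@greedy_save [set x; y] (fun z => if z == x then act b1 s0 else act b2 s0) v
          (b1, x) (b2, y)) => //.
- have only e : E e x y -> e = b.
    by case: (e =P b) => // /eqP; case: e b nExy {neq_b Exy} => -[] //= /negPf->.
  move=> e z1 z2 /set2P[]-> /set2P[]->; rewrite ?E_irr ?eqxx ?(eq_sym y) ?(negPf xy) //.
    move/only->; rewrite actD; apply: actN.
    by case: b b1 b2 neq_b {Ex Ey Exy nExy only} => -[] [].
  rewrite E_sym => /only->; rewrite actD; apply: actN.
  by case: b b1 b2 neq_b {Ex Ey Exy nExy only} => -[] [].
- move=> X /set0Pn[x0 x0X] dX; exists x0, v; split=> //.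
    apply: compl; apply: contraTneq x0X => ->; apply/negP=> /(disjointFr dX).
    by rewrite !inE eqxx.
  rewrite !inE (negPf (neq _ _ _ Ex)) (negPf (neq _ _ _ Ey)) /=.
  by apply/negP=> /(disjointFr dX); rewrite !inE eqxx.
- by rewrite !inE negb_or (neq _ _ _ Ex) (neq _ _ _ Ey).
- by rewrite !inE Ex eqxx.
- by rewrite !inE Ey eqxx orbT.
- by rewrite xpair_eqE (negPf xy) andbF.
- by rewrite /= eqxx eq_sym (negPf xy) !actK.
Qed.

End Greedy.

(** * Signed multigraphs and the parity identity *)

Section Multigraph.
Variable G : mgraph.
Implicit Types (e : edge G) (u v w : vert G) (C : {set edge G}).

Lemma ends_other e u : u \in ends e -> exists v, ends e = [set u; v].
Proof.
have /cards2P[x [y [_ ->]]] : #|ends e| == 2 by rewrite card_ends.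
by case/set2P=> ->; [exists y | exists x; rewrite setUC].
Qed.

Lemma ends_inj e u v w : ends e = [set u; v] -> ends e = [set u; w] -> v = w.
Proof.
move=> euv euw; have: v \in [set u; w] by rewrite -euw euv !inE eqxx orbT.
case/set2P=> // vu; have := card_ends e.
by rewrite euv vu cards2 eqxx.
Qed.

Lemma big_ends (f : vert G -> bool) e u v :
  ends e = [set u; v] -> \big[addb/false]_(x in ends e) f x = f u (+) f v.
Proof.
move=> euv; have uv : u != v by apply: (@ends_neq _ e); rewrite euv.
by rewrite euv big_setU1 ?inE //= big_set1.
Qed.

Lemma addb_const (T : finType) (A : {set T}) b :
  \big[addb/false]_(x in A) b = odd #|A| && b.
Proof.
rewrite big_const; elim: #|A| => //= n ->.
by case: b; case: (odd n).
Qed.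

(** After exchanging the sums, [f v] is added [deg_in C v] times. *)
Lemma even_deg_sum C (f : vert G -> bool) :
    (forall v, ~~ odd (deg_in C v)) ->
  \big[addb/false]_(e in C) \big[addb/false]_(v in ends e) f v = false.
Proof.
move=> evenC; rewrite (exchange_big_dep predT) //=; apply: big1 => v _.
transitivity (\big[addb/false]_(e in [set e in C | v \in ends e]) f v).
  by apply: eq_bigl => e; rewrite inE.
by rewrite addb_const (negPf (evenC v)).
Qed.

Section SignedAdjacency.
Variables (C : {set edge G}) (tau : edge G -> bool).

(** The parameters [C] and [tau] allow edges to be deleted and the signature to be replaced: with
    [tau] constantly false, sign-respecting colourings are ordinary ones. *)
Definition sadj b : rel (vert G) :=
  fun u v => [exists e in C, (ends e == [set u; v]) && (tau e == b)].

Lemma sadjP b u v :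
  reflect (exists e, [/\ e \in C, ends e = [set u; v] & tau e = b]) (sadj b u v).
Proof.
apply: (iffP exists_inP) => [[e eC /andP[/eqP ee /eqP te]]|[e [eC ee te]]].
  by exists e.
by exists e; rewrite // ee te !eqxx.
Qed.

Lemma sadj_sym b : symmetric (sadj b).
Proof. by move=> u v; apply: eq_existsb => e; rewrite setUC. Qed.

Lemma sadj_irr b : irreflexive (sadj b).
Proof.
by move=> u; apply/sadjP=> -[e [_ /eqP/ends_neq]]; rewrite eqxx.
Qed.

Lemma adj_sadj u v : adj sadj u v = adj_in C u v.
Proof.
apply/orP/exists_inP => [[]/sadjP[e [eC ee _]]|[e eC /eqP ee]].
- by exists e; rewrite ?ee.
- by exists e; rewrite ?ee.
- by case te: (tau e); [left|right]; apply/sadjP; exists e.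
Qed.

Definition other e u := odflt u [pick v | ends e == [set u; v]].

Lemma ends_otherE e u : u \in ends e -> ends e = [set u; other e u].
Proof.
move=> /ends_other[v euv]; rewrite /other; case: pickP => [w /eqP //|/(_ v)].
by rewrite euv eqxx.
Qed.

Lemma nb_sadj u :
  nb sadj u setT = [set (tau e, other e u) | e in [set e in C | u \in ends e]].
Proof.
apply/setP=> -[b v]; rewrite !inE andbT.
apply/sadjP/imsetP => [[e [eC euv te]]|[e]].
  have ue : u \in ends e by rewrite euv !inE eqxx.
  exists e; rewrite ?inE ?eC // te.
  by congr pair; apply: ends_inj euv (ends_otherE ue).
by rewrite inE => /andP[eC ue] [-> ->]; exists e; split=> //; apply: ends_otherE.
Qed.

Lemma card_nb_sadj u : #|nb sadj u setT| <= deg_in C u.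
Proof. by rewrite nb_sadj leq_imset_card. Qed.

(** Equality of the two numbers makes the map from edges at [u] to pairs of sign and other end
    injective. *)
Lemma sadj_edge_inj u v e1 e2 :
    #|nb sadj u setT| = deg_in C u -> e1 \in C -> e2 \in C ->
    ends e1 = [set u; v] -> ends e2 = [set u; v] -> tau e1 = tau e2 ->
  e1 = e2.
Proof.
rewrite nb_sadj => /eqP/imset_injP inj e1C e2C ee1 ee2 tee.
have ue e : ends e = [set u; v] -> u \in ends e by move=> ->; rewrite !inE eqxx.
apply: inj; rewrite ?inE ?e1C ?e2C ?ue //; congr pair => //.
rewrite -(ends_inj ee1 (ends_otherE (ue _ ee1))).
by rewrite -(ends_inj ee2 (ends_otherE (ue _ ee2))).
Qed.

Lemma connected_cut (X : {set vert G}) :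
    connected_in setT C -> X != set0 -> X != setT ->
  exists x y, [/\ x \in X, y \notin X & adj_in C x y].
Proof.
case/andP=> _ /forall_inP conC /set0Pn[x xX] XT.
have [y yX] : exists y, y \notin X.
  apply/existsP; rewrite -negb_forall; apply: contra XT => /forallP XT.
  by apply/eqP/setP=> y; rewrite inE XT.
have [/existsP[a /existsP[b /and3P[aX bX ab]]]|no_cross] :=
    boolP [exists a, exists b, [&& a \in X, b \notin X & adj_in C a b]].
  by exists a, b.
have cross a b : adj_in C a b -> a \in X -> b \in X.
  move=> ab aX; apply: contraNT no_cross => bX.
  by apply/existsP; exists a; apply/existsP; exists b; rewrite aX bX.
have clX : closed (adj_in C) (mem X).
  move=> a b ab; apply/idP/idP; apply: cross => //.
  by move: ab; rewrite /adj_in; under eq_existsb do rewrite setUC.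
have /forall_inP/(_ y (in_setT y)) := conC x (in_setT x).
by move/(closed_connect clX); rewrite xX (negPf yX).
Qed.

Hypothesis deg2 : forall v, deg_in C v = 2.

(** Across an edge [e], the colours of the ends add up to [~~ tau e]; in the sum over [C] every
    vertex occurs twice. *)
Lemma two_regular_coloring_parity (f : vert G -> bool) :
    (forall b u v, sadj b u v -> f u != b (+) f v) ->
  \big[addb/false]_(e in C) ~~ tau e = false.
Proof.
move=> fP; rewrite -[RHS](@even_deg_sum C f) => [|v]; last by rewrite deg2.
apply: eq_bigr => e eC.
have /cards2P[u [v [_ euv]]] : #|ends e| == 2 by rewrite card_ends.
have: sadj (tau e) u v by apply/sadjP; exists e.
by rewrite (big_ends _ euv) => /fP; case: (f u) (f v) (tau e) => -[] [].
Qed.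

End SignedAdjacency.

(* Delete an edge, colour the rest greedily, and let the parity identity force
   the deleted edge to be properly coloured too. *)
Lemma two_regular_coloring C (tau : edge G -> bool) :
    (forall v, deg_in C v = 2) -> connected_in setT C ->
    \big[addb/false]_(e in C) ~~ tau e = false ->
  exists f : vert G -> bool, forall b u v, sadj C tau b u v -> f u != b (+) f v.
Proof.
move=> deg2 conC parity.
have [v0 _] : exists v0 : vert G, v0 \in setT.
  by apply/set0Pn; case/andP: conC.
have [e1 e1C] : exists e1, e1 \in C.
  have: 0 < deg_in C v0 by rewrite deg2.
  by case/card_gt0P=> e; rewrite inE => /andP[]; exists e.
pose E := sadj (C :\ e1) tau.
have degD u : deg_in (C :\ e1) u <= deg_in C u.
  by apply/subset_leq_card/subsetP=> e; rewrite !inE => /andP[/andP[_ ->]].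
have degD1 u : u \in ends e1 -> deg_in (C :\ e1) u < 2.
  move=> ue; rewrite -(deg2 u) /deg_in [X in _ < X](cardsD1 e1) inE e1C ue /=.
  by rewrite ltnS; apply/subset_leq_card/subsetP=> e; rewrite !inE andbA.
have [|||f fP _] := @greedy _ bool addb E addKb (@sadj_sym _ _) (@sadj_irr _ _)
    set0 set0 (fun=> true).
- by rewrite -setI_eq0 set0I.
- by move=> b x y; rewrite inE.
- move=> X nzX _; rewrite !set0U card_bool.
  (* A set meeting the deleted edge has a vertex of degree below two; any other set is proper, and
     the edge leaving it is not [e1]. *)
  have [/existsP[x /andP[xX xe]]|endsX] := boolP [exists x in X, x \in ends e1].
    exists x => //; apply: leq_ltn_trans (degD1 x xe).
    apply: leq_trans (card_nb_sadj (C :\ e1) tau x).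
    by apply/subset_leq_card/nbS/subsetT.
  have notX x : x \in ends e1 -> x \notin X.
    by move=> xe; apply: contra endsX => xX; apply/exists_inP; exists x.
  have XT : X != setT.
    have /cards2P[x [y [_ e1xy]]] : #|ends e1| == 2 by rewrite card_ends.
    by apply: contraTneq (notX x _) => [->|]; rewrite ?e1xy !inE ?eqxx.
  have [x [y [xX yX /exists_inP[e eC /eqP exy]]]] := connected_cut conC nzX XT.
  exists x => //; rewrite -(deg2 x); apply: leq_trans (degD x).
  apply: leq_trans (card_nb_sadj (C :\ e1) tau x); apply: nb_lt yX.
  apply/adjP; exists (tau e); apply/sadjP; exists e; split=> //.
  rewrite !inE eC andbT; apply: contraTneq xX => eqe; apply: notX.
  by rewrite -eqe exy !inE eqxx.
rewrite setC0 in fP; exists f.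
have ok e : e \in C :\ e1 -> \big[addb/false]_(v in ends e) f v = ~~ tau e.
  move=> eC; have /cards2P[u [v [_ euv]]] : #|ends e| == 2 by rewrite card_ends.
  have: E (tau e) u v by apply/sadjP; exists e.
  rewrite (big_ends _ euv) => /fP; rewrite !inE => /(_ isT isT).
  by case: (f u) (f v) (tau e) => -[] [].
(* Over [C] both sides add up to false, by even degrees and by hypothesis; all other terms agree,
   hence so do those of [e1]. *)
have ok1 : \big[addb/false]_(v in ends e1) f v = ~~ tau e1.
  have: \big[addb/false]_(e in C) \big[addb/false]_(v in ends e) f v
      = \big[addb/false]_(e in C) ~~ tau e.
    by rewrite parity even_deg_sum // => v; rewrite deg2.
  rewrite (big_setD1 e1) //= (big_setD1 e1 (A := C)) //= (eq_bigr _ ok).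
  exact: addIb.
move=> b u v /sadjP[e [eC euv <-]].
have: \big[addb/false]_(v in ends e) f v = ~~ tau e.
  by have [->//|ne] := eqVneq e e1; apply: ok; rewrite !inE ne.
by rewrite (big_ends _ euv); case: (f u) (f v) (tau e) => -[] [].
Qed.

End Multigraph.

(** * Colourings by symmetric sets *)

Lemma symactK t k b : involutive (@symact t k b).
Proof. by case: b => // -[i|[j e]] //=; rewrite negbK. Qed.

Lemma symactD t k e f (s : symset t k) : symact e (symact f s) = symact (e (+) f) s.
Proof. by case: e f s => -[] //= [i|[j b]] //=; rewrite negbK. Qed.

Lemma card_symset t k : #|symset t k| = t + 2 * k.
Proof. by rewrite card_sum card_prod !card_ord card_bool mulnC. Qed.

(** * Chromatic number, complete graphs and circuits *)

Section Colorable.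
Variable G : mgraph.

Lemma colorableP n :
  reflect (exists c : vert G -> 'I_n, forall u v, adj_in setT u v -> c u != c v)
    (colorable G n).
Proof.
apply: (iffP existsP) => [[c /forallP cP]|[c cP]].
  exists c => u v /exists_inP[e _ euv].
  by have /forallP/(_ u)/forallP/(_ v)/implyP/(_ euv) := cP e.
exists (finfun c); apply/forallP=> e; apply/forallP=> u; apply/forallP=> v.
apply/implyP=> euv; rewrite !ffunE; apply: cP.
by apply/exists_inP; exists e; rewrite ?inE.
Qed.

Lemma colorable_mono m n : m <= n -> colorable G m -> colorable G n.
Proof.
move=> lemn /colorableP[c cP]; apply/colorableP.
have inj : injective (widen_ord lemn) by move=> x y /(congr1 val)/= /val_inj.
by exists (widen_ord lemn \o c) => u v /cP; rewrite (inj_eq inj).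
Qed.

Lemma chi_leP n : reflect (chi G <= n) (colorable G n).
Proof.
rewrite /chi; case: ex_minnP => m mP min_m; apply: (iffP idP); first exact: min_m.
by move=> lemn; apply: colorable_mono mP.
Qed.

Lemma deg_maxdeg (v : vert G) : deg_in setT v <= maxdeg G.
Proof. exact: leq_bigmax. Qed.

Lemma chi_maxdeg : chi G <= (maxdeg G).+1.
Proof.
apply/chi_leP/colorableP.
pose E := @sadj G setT (fun=> false).
have [|||||c cP] := @greedy_all _ 'I_(maxdeg G).+1 (fun _ s => s) E.
- by [].
- exact: sadj_sym.
- exact: sadj_irr.
- by rewrite card_ord.
- by move=> u; rewrite card_ord ltnS (leq_trans _ (deg_maxdeg u)) // card_nb_sadj.
exists c => u v; rewrite -(adj_sadj _ (fun=> false)) => /adjP[b].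
exact: cP.
Qed.

Lemma completeP :
  reflect (forall u v : vert G, u != v ->
             exists e, forall e', ends e' = [set u; v] <-> e' = e)
    (complete G).
Proof.
apply: (iffP forallP) => [comp u v uv|comp u].
  have /forallP/(_ v)/implyP/(_ uv)/cards1P[e /setP ee] := comp u.
  exists e => e'; have := ee e'; rewrite !inE => eqe'.
  by split=> /eqP; [rewrite eqe' => /eqP | rewrite -eqe' => /eqP].
apply/forallP=> v; apply/implyP=> /comp[e eP]; apply/cards1P; exists e.
by apply/setP=> e'; rewrite !inE; apply/eqP/eqP => /eP.
Qed.

(** In a complete graph an edge at [v] is determined by its other end, which differs from [v]. *)
Lemma complete_maxdeg : 0 < #|vert G| -> complete G -> maxdeg G < #|vert G|.
Proof.
move=> V_gt0 /completeP comp; suff: maxdeg G <= #|vert G|.-1 by case: #|_| V_gt0.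
apply/bigmax_leqP=> v _; rewrite -cardsT (cardsD1 v) inE /=.
pose E := [set e : edge G | v \in ends e].
have inj : {in E &, injective (fun e => other e v)}.
  move=> e1 e2; rewrite !inE => /ends_otherE ee1 /ends_otherE ee2 eq_o.
  have [|e eP] := comp v (other e1 v); first by apply: (@ends_neq _ e1); rewrite -ee1.
  by rewrite ((eP e1).1 ee1) ((eP e2).1 _) // eq_o.
have -> : deg_in setT v = #|E| by apply: eq_card => e; rewrite !inE.
rewrite -(card_in_imset inj); apply/subset_leq_card/subsetP=> w /imsetP[e].
rewrite !inE andbT eq_sym => /ends_otherE ee ->.
by apply: (@ends_neq _ e); rewrite -ee.
Qed.

Lemma circuitP :
  reflect ((forall v : vert G, deg_in setT v = 2) /\ connected G) (circuit G).
Proof.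
apply: (iffP and3P) => [[_ conG /forall_inP deg2]|[deg2 conG]].
  by split=> // v; apply/eqP/deg2; rewrite inE.
split=> //; first by apply/forall_inP=> e _; apply: subsetT.
by apply/forall_inP=> v _; rewrite deg2.
Qed.

Lemma circuit_maxdeg : circuit G -> maxdeg G = 2.
Proof.
case/circuitP=> deg2 /andP[/set0Pn[v _] _].
apply/eqP; rewrite eqn_leq -[X in _ && (X <= _)](deg2 v) deg_maxdeg andbT.
by apply/bigmax_leqP=> u _; rewrite deg2.
Qed.

End Colorable.

(** * Symmetric palettes, balance and switching *)

Section Signature.
Variables (G : mgraph) (sigma : edge G -> bool).
Notation E := (sadj setT sigma).

Lemma sym_colorableP t k :
  reflect (exists c, proper_on (@symact t k) E setT c) (sym_colorable sigma t k).
Proof.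
apply: (iffP existsP) => [[c /forallP cP]|[c cP]].
  exists c => b u v _ _ /sadjP[e [_ euv <-]].
  by have /forallP/(_ u)/forallP/(_ v)/implyP := cP e; apply; rewrite euv.
exists (finfun c); apply/forallP=> e; apply/forallP=> u; apply/forallP=> v.
apply/implyP=> /eqP euv; rewrite !ffunE; apply: cP; rewrite ?inE //.
by apply/sadjP; exists e; rewrite ?inE.
Qed.

Lemma sym_colorable_mono t k l :
  k <= l -> sym_colorable sigma t k -> sym_colorable sigma t l.
Proof.
move=> lekl /sym_colorableP[c cP]; apply/sym_colorableP.
pose h (s : symset t k) : symset t l :=
  match s with inl i => inl i | inr (j, b) => inr (widen_ord lekl j, b) end.
have h_inj : injective h.
  move=> [i|[j b]] [i'|[j' b']] //= [] // => [-> //|/eqP eqj ->].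
  by congr (inr (_, _)); apply/val_inj/eqP.
have h_act b s : symact b (h s) = h (symact b s).
  by case: b s => -[i|[j b]].
by exists (h \o c) => b u v _ _ Euv; rewrite /= h_act (inj_eq h_inj) cP ?inE.
Qed.

(** Without pairs of opposite colours the signs act trivially. *)
Lemma sym_colorable0 t : sym_colorable sigma t 0 <-> chi G <= t.
Proof.
split=> [/sym_colorableP[c cP]|/chi_leP/colorableP[c cP]].
  apply/chi_leP/colorableP.
  have [f fP] : exists f : vert G -> 'I_t, forall v, c v = inl (f v).
    pose f v : 'I_t :=
      match c v with inl i => i | inr (j, _) => False_rect _ (notF (valP j)) end.
    by exists f => v; rewrite /f; case: (c v) => // -[[]].
  exists f => u v; rewrite -(adj_sadj _ sigma) => /adjP[b /cP].
  rewrite !inE !fP => /(_ isT isT); apply: contraNneq => ->.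
  by rewrite /symact; case: b.
apply/sym_colorableP; exists (fun v => inl (c v)) => b u v _ _ Euv.
have: adj_in setT u v by rewrite -(adj_sadj _ sigma); apply/adjP; exists b.
by move/cP; apply: contraNneq; case: b {Euv} => -[->].
Qed.

Lemma greedy_sym t k : maxdeg G < t + 2 * k -> sym_colorable sigma t k.
Proof.
move=> ltD; apply/sym_colorableP.
apply: greedy_all; rewrite ?card_symset.
- exact: symactK.
- exact: sadj_sym.
- exact: sadj_irr.
- exact: leq_ltn_trans ltD.
move=> u; apply: leq_ltn_trans ltD.
by apply: leq_trans (deg_maxdeg u); apply: card_nb_sadj.
Qed.

Lemma chi_sym_le t k : sym_colorable sigma t k -> chi_sym sigma t <= t + 2 * k.
Proof.
move=> tk; rewrite /chi_sym; case: ex_minnP => n _; apply.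
have ltk : k < (t + 2 * k).+1 by lia.
by apply/existsP; exists (Ordinal ltk); rewrite eqxx.
Qed.

Lemma chi_symP t : exists k, chi_sym sigma t = t + 2 * k /\ sym_colorable sigma t k.
Proof.
rewrite /chi_sym; case: ex_minnP => n /existsP[k /andP[/eqP def_n tk]] _.
by exists k.
Qed.

(** Possible sizes grow in steps of two. Failure at [k] excludes all smaller sizes by monotonicity,
    and the next size, [maxdeg G + 2], suffices for the greedy colouring. *)
Lemma chi_sym_maxdeg t k : t + 2 * k = maxdeg G ->
  (sym_colorable sigma t k -> chi_sym sigma t <= maxdeg G) /\
  (~~ sym_colorable sigma t k -> chi_sym sigma t = maxdeg G + 2).
Proof.
move=> eqD; split=> [/chi_sym_le|nc]; first by rewrite eqD.
apply/eqP; rewrite eqn_leq; apply/andP; split.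
  have: sym_colorable sigma t k.+1 by apply: greedy_sym; lia.
  by move/chi_sym_le; lia.
have [l [-> tl]] := chi_symP t; rewrite -eqD.
have : k < l by rewrite ltnNge; apply: contra nc => /sym_colorable_mono; apply.
by lia.
Qed.

Lemma positiveE (C : {set edge G}) :
  positive sigma C = ~~ \big[addb/false]_(e in C) sigma e.
Proof.
rewrite /positive; set p := (X in X == _).
have -> : p = ((-1) ^+ nat_of_bool (\big[addb/false]_(e in C) sigma e))%R.
  by rewrite {}/p; elim/big_rec2: _ => // e x y _ ->; rewrite GRing.signr_addb.
by case: (\big[_/_]_(_ in _) _).
Qed.

Lemma addb_negb (C : {set edge G}) (tau : edge G -> bool) :
  \big[addb/false]_(e in C) ~~ tau e = \big[addb/false]_(e in C) tau e (+) odd #|C|.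
Proof.
rewrite (eq_bigr (fun e => tau e (+) true)) => [|e _]; last by rewrite addbT.
by rewrite big_split /= addb_const andbT.
Qed.

(** A circuit inside the circuit [G] uses both edges at each of its vertices, so by connectedness it
    is [G] itself. *)
Lemma circuit_balanced :
  circuit G -> balanced sigma = ~~ \big[addb/false]_(e in setT) sigma e.
Proof.
move=> circG; rewrite -positiveE; apply/forallP/idP => [balG|posG W].
  by have /forallP/(_ setT)/implyP := balG setT; apply.
apply/forallP=> C; apply/implyP=> circC; suff -> : C = setT by [].
have [deg2 conG] := circuitP _ circG.
case/and3P: circC => /forall_inP subC /andP[nzW _] /forall_inP degC.
have allC w e : w \in W -> w \in ends e -> e \in C.
  move=> wW we; have: [set f in C | w \in ends f] == [set f in setT | w \in ends f].
    rewrite eqEcard; apply/andP; split.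
      by apply/subsetP=> f; rewrite !inE => /andP[_ ->].
    by move: (degC w wW) (deg2 w); rewrite /deg_in => /eqP-> ->.
  by move/eqP/setP/(_ e); rewrite !inE we andbT.
have WT : W = setT.
  apply/eqP; apply: contraT => /(connected_cut conG nzW)[x [y [xW yW]]].
  case/exists_inP=> e _ /eqP exy; case/negP: yW.
  have eC : e \in C by apply: (allC x); rewrite // exy !inE eqxx.
  by apply: (subsetP (subC e eC)); rewrite exy !inE eqxx orbT.
apply/setP=> e; rewrite inE.
have /cards2P[x [y [_ exy]]] : #|ends e| == 2 by rewrite card_ends.
by apply: (allC x); rewrite ?WT ?inE // exy !inE eqxx.
Qed.

(** The signature is the coboundary of [s]: switching at the vertices where [s] is true makes every
    edge positive. *)
Definition switching_of (s : vert G -> bool) :=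
  forall e u v, ends e = [set u; v] -> sigma e = s u (+) s v.

(** Each vertex lies on zero or two edges of a circuit, so the values of [s] cancel. *)
Lemma switching_balanced s : switching_of s -> balanced sigma.
Proof.
move=> sP; apply/forallP=> W; apply/forallP=> C; apply/implyP=> /and3P[].
move=> /forall_inP subC _ /forall_inP degC.
rewrite positiveE (eq_bigr (fun e => \big[addb/false]_(v in ends e) s v)) => [|e eC].
  rewrite even_deg_sum // => v.
  have [vW|vW] := boolP (v \in W); first by rewrite (eqP (degC v vW)).
  suff -> : deg_in C v = 0 by [].
  apply: eq_card0 => e; rewrite !inE; apply/negP=> /andP[eC ve].
  by case/negP: vW; apply: (subsetP (subC e eC)).
have /cards2P[x [y [_ exy]]] : #|ends e| == 2 by rewrite card_ends.
by rewrite (big_ends _ exy) (sP _ _ _ exy).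
Qed.

End Signature.

(** * Lower bounds for balanced complete graphs and for circuits *)

Section Sufficiency.
Variables (G : mgraph) (sigma : edge G -> bool).
Notation E := (sadj setT sigma).

(* The witness switches at the vertices joined to [x0] by a negative edge. *)
Lemma complete_switching :
    0 < #|vert G| -> complete G ->
    (forall x u v e1 e2 e, x != u -> x != v ->
       ends e1 = [set x; u] -> ends e2 = [set x; v] -> ends e = [set u; v] ->
     sigma e = sigma e1 (+) sigma e2) ->
  exists s, switching_of sigma s.
Proof.
case/card_gt0P=> x0 _ /completeP comp tri; exists (E true x0) => e u v euv.
have sE w e' : ends e' = [set x0; w] -> E true x0 w = sigma e'.
  move=> ee; have [|e1 e1P] := comp x0 w; first by apply: (@ends_neq _ e'); rewrite ee.
  apply/sadjP/idP => [[e2 [_ ee2 s2]]|se]; last by exists e'.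
  by rewrite ((e1P e').1 ee) -((e1P e2).1 ee2).
have [equ|xu] := eqVneq x0 u.
  by move: euv; rewrite -equ => euv; rewrite (sE _ _ euv) sadj_irr.
have [eqv|xv] := eqVneq x0 v.
  by move: euv; rewrite -eqv setUC => euv; rewrite (sE _ _ euv) sadj_irr addbF.
have [e1 e1P] := comp _ _ xu; have [e2 e2P] := comp _ _ xv.
have ee1 := (e1P e1).2 erefl; have ee2 := (e2P e2).2 erefl.
by rewrite (sE _ _ ee1) (sE _ _ ee2) (tri x0 u v e1 e2).
Qed.

(** The three edges form a circuit, whose positivity is the claim; most of the proof checks its
    connectedness and degrees. *)
Lemma balanced_triangle x u v e1 e2 e :
    balanced sigma -> x != u -> x != v ->
    ends e1 = [set x; u] -> ends e2 = [set x; v] -> ends e = [set u; v] ->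
  sigma e = sigma e1 (+) sigma e2.
Proof.
move=> bal xu xv ee1 ee2 ee.
have uv : u != v by apply: (@ends_neq _ e); rewrite ee.
pose W := [set x; u; v]; pose C := [set e1; e2; e].
have neq (f g : edge G) z : z \in ends f -> z \notin ends g -> f != g.
  by move=> zf; apply: contraNneq => <-.
have n12 : e1 != e2.
  by apply: (@neq _ _ u); rewrite ?ee1 ?ee2 !inE ?eqxx ?orbT // negb_or eq_sym xu.
have n1 : e1 != e.
  by apply: (@neq _ _ x); rewrite ?ee1 ?ee !inE ?eqxx ?orbT // negb_or xu.
have n2 : e2 != e.
  by apply: (@neq _ _ x); rewrite ?ee2 ?ee !inE ?eqxx ?orbT // negb_or xu.
have circ : circuit_in W C.
  apply/and3P; split.
  - apply/forall_inP=> f; rewrite !inE -orbA => /or3P[]/eqP->;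
    by rewrite ?ee1 ?ee2 ?ee; apply/subsetP=> z; rewrite !inE => /orP[]->; rewrite ?orbT.
  - apply/andP; split; first by apply/set0Pn; exists x; rewrite !inE eqxx.
    have adjC f a b : f \in C -> ends f = [set a; b] -> connect (adj_in C) a b.
      by move=> fC ef; apply/connect1/exists_inP; exists f; rewrite ?ef.
    have C1 : e1 \in C by rewrite !inE eqxx.
    have C2 : e2 \in C by rewrite !inE eqxx ?orbT.
    have C3 : e \in C by rewrite !inE eqxx ?orbT.
    apply/forall_inP=> a; rewrite !inE -orbA => aW; apply/forall_inP=> b.
    rewrite !inE -orbA => bW.
    case/or3P: aW => /eqP->; case/or3P: bW => /eqP->; rewrite ?connect0 //.
    + exact: adjC C1 ee1.
    + exact: adjC C2 ee2.
    + by apply: adjC C1 _; rewrite ee1 setUC.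
    + exact: adjC C3 ee.
    + by apply: adjC C2 _; rewrite ee2 setUC.
    + by apply: adjC C3 _; rewrite ee setUC.
  apply/forall_inP=> a aW.
  suff [f [g [fg deg_a]]] : exists f g,
      f != g /\ [set h in C | a \in ends h] = [set f; g].
    by rewrite /deg_in deg_a cards2 fg.
  move: aW; rewrite !inE -orbA => /or3P[]/eqP->.
  - exists e1, e2; split=> //; apply/setP=> h; rewrite !inE.
    have [->|h1] := eqVneq h e1; first by rewrite ee1 !inE eqxx.
    have [->|h2] := eqVneq h e2; first by rewrite ee2 !inE eqxx.
    by have [->|//] := eqVneq h e; rewrite ee !inE (negPf xu) (negPf xv).
  - exists e1, e; split=> //; apply/setP=> h; rewrite !inE.
    have [->|h1] := eqVneq h e1; first by rewrite ee1 !inE eqxx orbT.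
    have [->|h2] := eqVneq h e; first by rewrite ee !inE eqxx orbT.
    by have [->|//] := eqVneq h e2; rewrite ee2 !inE (eq_sym u) (negPf xu) (negPf uv).
  - exists e2, e; split=> //; apply/setP=> h; rewrite !inE.
    have [->|h1] := eqVneq h e2; first by rewrite ee2 !inE eqxx !orbT.
    have [->|h2] := eqVneq h e; first by rewrite ee !inE eqxx !orbT.
    by have [->|//] := eqVneq h e1; rewrite ee1 !inE !(eq_sym v) (negPf xv) (negPf uv).
have /forallP/(_ W)/forallP/(_ C)/implyP/(_ circ) := bal.
rewrite positiveE /C setUC big_setU1 ?inE ?negb_or ?(eq_sym e) ?n1 ?n2 //=.
rewrite big_setU1 ?inE ?n12 //= big_set1.
by case: (sigma e) (sigma e1) (sigma e2) => -[] [].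
Qed.

(** Switching turns [c] into an ordinary proper colouring, injective on a complete graph; but the
    [maxdeg G] colours are fewer than the vertices. *)
Lemma balanced_complete_uncolorable t k :
    0 < #|vert G| -> t + 2 * k = maxdeg G -> balanced sigma -> complete G ->
  ~~ sym_colorable sigma t k.
Proof.
move=> V_gt0 eqD bal compG; apply/negP=> /sym_colorableP[c cP].
have [s sP] : exists s, switching_of sigma s.
  by apply: complete_switching => // x u v e1 e2 e; apply: balanced_triangle.
have c_inj : injective (fun v => symact (s v) (c v)).
  move=> u v eqc; apply/eqP; apply: contraT => uv.
  have [e eP] := completeP _ compG _ _ uv; have euv := (eP e).2 erefl.
  have: E (sigma e) u v by apply/sadjP; exists e.
  move/cP; rewrite !inE => /(_ isT isT); rewrite (sP _ _ _ euv) -symactD -eqc.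
  by rewrite symactK eqxx.
have := leq_card _ c_inj; rewrite card_symset eqD leqNgt.
by rewrite complete_maxdeg.
Qed.

(** A sign acts on the two opposite colours as [addb] does on booleans, so the parity identity
    applies. *)
Lemma circuit_uncolorable0 :
    circuit G -> \big[addb/false]_(e in setT) ~~ sigma e ->
  ~~ sym_colorable sigma 0 1.
Proof.
move=> /circuitP[deg2 _] odd_neg; apply/negP=> /sym_colorableP[c cP].
pose f v := match c v with inl _ => true | inr (_, b) => b end.
move: odd_neg; rewrite (two_regular_coloring_parity deg2 (f := f)) // => b u v.
move/cP; rewrite !inE => /(_ isT isT); rewrite /f.
case: (c u) => [[]//|[i x]]; case: (c v) => [[]//|[j y]].
by rewrite !(ord1 i) !(ord1 j); case: b x y => -[] [].
Qed.

(** Both colours are self-inverse, so the parity identity is applied with all edges taken as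
    positive. *)
Lemma odd_circuit_uncolorable2 :
  circuit G -> odd (glength G) -> ~~ sym_colorable sigma 2 0.
Proof.
move=> /circuitP[deg2 _] oddG; apply/negP=> /sym_colorableP[c cP].
pose f v := match c v with inl i => i == ord0 | inr _ => true end.
have := two_regular_coloring_parity (C := setT) (tau := fun=> false) deg2 (f := f).
rewrite addb_const oddG => /(_ _)/negP[] // b u v /sadjP[e [_ euv <-]].
have: E (sigma e) u v by apply/sadjP; exists e.
move/cP; rewrite !inE => /(_ isT isT); rewrite /f.
case: (c u) => [i|[[]//]]; case: (c v) => [j|[[]//]].
by case: (sigma e); case: i j => [[|[|//]] ?] [[|[|//]] ?].
Qed.

End Sufficiency.

(** * Uncolorable signed graphs *)

Section Necessity.
Variables (G : mgraph) (sigma : edge G -> bool) (t k : nat).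
Hypothesis conG : connected G.
Hypothesis tkD : t + 2 * k = maxdeg G.
Hypothesis uncol : ~~ sym_colorable sigma t k.
Notation E := (sadj setT sigma).
Notation act := (@symact t k).
Implicit Types (u v x y : vert G) (b : bool).

Let E_sym : forall b, symmetric (E b).
Proof. exact: sadj_sym. Qed.

Let E_irr : forall b, irreflexive (E b).
Proof. exact: sadj_irr. Qed.

Let nb_le u : #|nb E u setT| <= #|symset t k|.
Proof. by rewrite card_symset tkD (leq_trans (card_nb_sadj _ _ _)) ?deg_maxdeg. Qed.

Let cutG (X : {set vert G}) : X != set0 -> X != setT ->
  exists x y, [/\ x \in X, y \notin X & adj E x y].
Proof.
move=> nzX XT; have [x [y [xX yX xy]]] := connected_cut conG nzX XT.
by exists x, y; rewrite adj_sadj.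
Qed.

Let uncolE : ~ exists c, proper_on act E setT c.
Proof. by move/sym_colorableP; apply/negP. Qed.

Lemma uncolorable_nb u : #|nb E u setT| = maxdeg G.
Proof.
rewrite (nb_regular (@symactK t k) E_sym E_irr nb_le cutG uncolE).
by rewrite card_symset.
Qed.

Lemma uncolorable_deg u : deg_in setT u = maxdeg G.
Proof.
by apply/eqP; rewrite eqn_leq deg_maxdeg -[X in X <= _](uncolorable_nb u) card_nb_sadj.
Qed.

Lemma uncolorable_edge_inj u v (e1 e2 : edge G) :
    ends e1 = [set u; v] -> ends e2 = [set u; v] -> sigma e1 = sigma e2 ->
  e1 = e2.
Proof.
by apply: (@sadj_edge_inj G setT sigma); rewrite ?inE // uncolorable_nb uncolorable_deg.
Qed.

(** Here [(t, k)] is [(2, 0)] or [(0, 1)]. By [two_regular_coloring], uncolourability makes odd the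
    length in the first case, the number of positive edges in the second. *)
Lemma uncolorable_circuit : maxdeg G = 2 ->
  (balanced sigma /\ circuit G /\ odd (glength G)) \/
  (~~ balanced sigma /\ circuit G /\ ~~ odd (glength G) /\ t = 0) \/
  (~~ balanced sigma /\ circuit G /\ odd (glength G) /\ t = 2).
Proof.
move=> D2; have deg2 v : deg_in setT v = 2 by rewrite uncolorable_deg.
have circG : circuit G by apply/circuitP.
have balE := circuit_balanced sigma circG.
have [t2|t0] : t = 2 /\ k = 0 \/ t = 0 /\ k = 1 by lia.
  have oddG : odd (glength G).
    apply: contraT => evenG; case: uncolE.
    have [|f fP] := @two_regular_coloring G setT (fun=> false) deg2 conG.
      by rewrite addb_const (negPf evenG).
    have t_gt1 : 1 < t by case: t2 => ->.
    exists (fun v => inl (if f v then Ordinal t_gt1 else Ordinal (ltnW t_gt1))).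
    move=> b u v _ _ Euv; have: sadj setT (fun=> false) false u v.
      by case/sadjP: Euv => e [_ euv _]; apply/sadjP; exists e.
    by move/fP; case: b (f u) (f v) {Euv} => -[] [].
  case balG: (balanced sigma); first by left.
  by right; right; case: t2.
have parity : \big[addb/false]_(e in setT) ~~ sigma e.
  apply: contraT => even_neg; case: uncolE.
  have [|f fP] := @two_regular_coloring G setT sigma deg2 conG.
    exact: negbTE.
  have k_gt0 : 0 < k by case: t0 => _ ->.
  exists (fun v => inr (Ordinal k_gt0, f v)) => b u v _ _ /fP.
  by case: b (f u) (f v) => -[] [].
(* The number of positive edges being odd, a balanced circuit has odd length and an unbalanced one
   even length. *)
move: parity; rewrite addb_negb; case balG: (balanced sigma) balE.
  by move/esym/negbTE=> ->; left.
by move/esym/negbFE=> -> /= evenG; right; left; case: t0.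
Qed.

(** If [k = 0], then [t = maxdeg G] lies below [chi G], which is at most [maxdeg G + 1]. If [k > 0],
    some colour is not self-inverse, so all triangles are positive and a switching exists. *)
Lemma uncolorable_simple_complete :
    (forall u v, u != v -> adj E u v) -> (forall u v, E true u v -> ~~ E false u v) ->
  (complete G /\ t = (chi G).-1 /\ (chi G).-1 = maxdeg G) \/
  (balanced sigma /\ complete G).
Proof.
move=> adjT simp.
have compG : complete G.
  apply/completeP=> u v /adjT/adjP[b /sadjP[e [_ euv se]]]; exists e => e'.
  split=> [e'uv|-> //]; apply: (uncolorable_edge_inj e'uv euv).
  have Ee : E (sigma e) u v by apply/sadjP; exists e.
  have Ee' : E (sigma e') u v by apply/sadjP; exists e'.
  apply/eqP; apply: contraT => neqs; suff: E true u v && E false u v.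
    by case/andP=> /simp/negPf->.
  by move: neqs Ee Ee'; case: (sigma e) (sigma e') => -[] //= _ -> ->.
have [k0|k_gt0] := posnP k; [left|right]; split=> //.
  have tD : t = maxdeg G by lia.
  have := uncol; rewrite k0 => nc.
  have : t < chi G.
    by rewrite ltnNge; apply: contra nc => lec; apply/sym_colorable0.
  by have := chi_maxdeg G; lia.
have V_gt0 : 0 < #|vert G|.
  by case/andP: conG => /set0Pn[x _] _; apply/card_gt0P; exists x.
have [|s sP] := complete_switching (sigma := sigma) V_gt0 compG; last first.
  exact: switching_balanced sP.
move=> x u v e1 e2 e xu xv ee1 ee2 ee.
apply: (@single_triangle _ _ act E (@symactK t k) E_sym E_irr nb_le uncolE
  (inr (Ordinal k_gt0, true)) _ _ _ x u v) => //.
- exact: symactD.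
- by apply/sadjP; exists e.
- have: E (sigma e) u v by apply/sadjP; exists e.
  case: (sigma e) => [/simp //|] Ef; apply/negP=> /simp.
  by rewrite Ef.
- by apply/sadjP; exists e1.
- by apply/sadjP; exists e2.
Qed.

Lemma uncolorable_single : 0 < t -> forall u v, E true u v -> ~~ E false u v.
Proof.
move=> t_gt0 u v Et; apply/negP=> Ef.
by apply: (fixed_color_single (@symactK t k) E_sym E_irr nb_le cutG uncolE
  (s0 := inl (Ordinal t_gt0)) (v := u) (a := v)).
Qed.

Lemma doubled_of_double :
    2 < #|vert G| ->
    (forall b u v, adj E u v -> E b u v) ->
    (forall u v, u != v -> adj E u v) \/
      odd #|vert G| /\ (forall v, #|[set u | adj E v u]| = 2) ->
  doubled_brooks sigma.
Proof.
move=> V_gt2 dbl shape; apply/and3P; split=> //.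
  apply/forallP=> u; apply/forallP=> v; apply/implyP; rewrite -(adj_sadj _ sigma) => uv.
  apply/forallP=> b; have /sadjP[e [_ euv se]] := dbl b u v uv.
  apply/cards1P; exists e; apply/setP=> e'; rewrite !inE.
  apply/andP/eqP => [[/eqP e'uv /eqP se']|->]; last by rewrite euv se !eqxx.
  by apply: (uncolorable_edge_inj e'uv euv); rewrite se' se.
apply/orP; case: shape => [adjT|[oddV nb2]]; [left|right].
  apply/forallP=> u; apply/forallP=> v; apply/implyP=> /adjT.
  by rewrite adj_sadj.
rewrite oddV; apply/forallP=> v; rewrite -(nb2 v); apply/eqP/eq_card => u.
by rewrite !inE adj_sadj.
Qed.

(** For [t = 0 < k], one pair joined by a single sign makes all pairs so: if [x y] is such a pair,
    [single_triangle] determines the sign of every edge [v x]. If all pairs are double,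
    [doubled_brooks] holds, which is excluded. *)
Lemma uncolorable_complete :
    (forall u v, u != v -> adj E u v) -> maxdeg G != 2 ->
    ~ (t = 0 /\ doubled_brooks sigma) ->
  forall u v, E true u v -> ~~ E false u v.
Proof.
move=> adjT D2 nd; have [t0|/uncolorable_single //] := posnP t.
have [k0|k_gt0] := posnP k.
  move=> u v Etuv; have := uncolorable_nb u; rewrite -tkD t0 k0 => /eqP.
  by rewrite cards_eq0 => /eqP/setP/(_ (true, v)); rewrite !inE Etuv.
pose single u v := adj E u v && ~~ (E true u v && E false u v).
have singleN u v : single u v = single v u.
  by rewrite /single adj_sym // !(E_sym _ u).
have tri x y v : single x y -> v != x -> v != y -> single v x.
  case/andP=> /adjP[b Eb] sxy vx vy; rewrite /single adjT //=.
  apply/negP=> /andP[Et Ef].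
  have [b2 Ey] := adjP _ _ _ (adjT _ _ vy).
  have nEb : ~~ E (~~ b) x y by move: Eb sxy; case: b => ->; rewrite ?andbT.
  have T b1 : E b1 v x -> b = b1 (+) b2.
    move=> E1; apply: (@single_triangle _ _ act E (@symactK t k) E_sym E_irr nb_le uncolE
      (inr (Ordinal k_gt0, true)) _ _ _ v x y) => //.
    exact: symactD.
  by have := T _ Et; rewrite (T _ Ef); case: (b2).
have [/existsP[x /existsP[y xy]]|dbl] := boolP [exists x, exists y, single x y].
  have xs v : v != x -> single x v.
    move=> vx; rewrite singleN; have [->|vy] := eqVneq v y; first by rewrite singleN.
    exact: tri xy vx vy.
  move=> u v Et; apply/negP=> Ef.
  have uv : u != v by apply: contraTneq Et => ->; rewrite E_irr.
  suff /andP[_] : single u v by rewrite Et Ef.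
  have [ux|ux] := eqVneq u x; first by rewrite ux in uv *; apply: xs; rewrite eq_sym.
  rewrite singleN; have [->|vx] := eqVneq v x; first exact: xs.
  by apply: (@tri u x); rewrite 1?singleN ?xs // eq_sym.
have dblP b u v : adj E u v -> E b u v.
  move=> uv; move: dbl; rewrite negb_exists => /forallP/(_ u).
  rewrite negb_exists => /forallP/(_ v); rewrite /single uv negbK /= => /andP[].
  by case: b.
case: nd; split=> //; apply: doubled_of_double; [|exact: dblP|by left].
(* On at most two vertices there are at most two constraints at each; as [maxdeg G] is even and
   positive, it would be 2. *)
rewrite ltnNge; apply: contra D2 => leV.
have [u _] : exists u : vert G, u \in setT by apply/set0Pn; case/andP: conG.
have D_gt0 : 0 < maxdeg G by lia.
have le2 : maxdeg G <= 2.
  rewrite -(uncolorable_nb u).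
  apply: leq_trans (_ : #|setX [set: bool] [set~ u]| <= 2).
    apply/subset_leq_card/subsetP=> -[b v]; rewrite !inE /= andbT => Ebu.
    by apply: contraTneq Ebu => ->; rewrite E_irr.
  rewrite cardsX cardsT card_bool cardsC1.
  by move: leV; case: #|_| => [|[|[]]].
by rewrite eqn_leq le2; lia.
Qed.

(** The positive edges form a spanning cycle of even length, which is 2-colourable. The two colours
    used are distinct even up to sign, so negative edges are satisfied too. *)
Lemma double_cycle_colorable :
    t = 0 -> (forall b u v, adj E u v -> E b u v) -> maxdeg G = 4 ->
    (forall v, exists x y, x != y /\ [set z | adj E v z] = [set x; y]) ->
  odd #|vert G|.
Proof.
move=> t0 dbl D4 nb2; apply: contraT => evenV; case: uncolE.
pose C := [set e | ~~ sigma e].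
have adjCE b u v : adj E u v ->
    exists e, [/\ ends e = [set u; v], sigma e = b & (e \in C) = ~~ b].
  by case/(dbl b)/sadjP=> e [_ euv <-]; exists e; rewrite inE.
have deg_ge2 (D : {set edge G}) v :
    (forall u, adj E v u -> exists2 e, e \in D & ends e = [set v; u]) -> 2 <= deg_in D v.
  move=> DP; have [x [y [xy /setP nv]]] := nb2 v.
  have [|e eD ee] := DP x; first by have := nv x; rewrite !inE eqxx.
  have [|f fD ef] := DP y; first by have := nv y; rewrite !inE eqxx orbT.
  have nef : e != f.
    by apply: contraNneq xy => eqef; apply/eqP/(ends_inj ee); rewrite eqef.
  apply: leq_trans (_ : #|[set e; f]| <= _); first by rewrite cards2 nef.
  apply/subset_leq_card/subsetP=> h; rewrite !inE.
  by case/orP=> /eqP->; rewrite ?eD ?fD ?ee ?ef !inE eqxx.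
(* There are at least two positive and two negative edges at [v], and four edges in all. *)
have degC v : deg_in C v = 2.
  have ge2 : 2 <= deg_in C v.
    by apply: deg_ge2 => u /(adjCE false)[e [ee _ eC]]; exists e.
  have ge2' : 2 <= deg_in (~: C) v.
    by apply: deg_ge2 => u /(adjCE true)[e [ee _ eC]]; exists e; rewrite // inE eC.
  have: deg_in C v + deg_in (~: C) v = 4.
    rewrite -D4 -(uncolorable_deg v) /deg_in -(cardsID C [set e in setT | v \in ends e]).
    by congr (_ + _); apply: eq_card => e; rewrite !inE 1?andbC.
  lia.
have adjC : adj_in C =2 adj_in setT.
  move=> u v; apply/exists_inP/exists_inP => [[e _ ee]|[e _ ee]]; first by exists e.
  have [|f [ef _ fC]] := @adjCE false u v; last by exists f; rewrite ?ef ?fC.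
  by rewrite adj_sadj; apply/exists_inP; exists e.
have conC : connected_in setT C.
  case/andP: conG => nz con; rewrite /connected_in nz /=.
  apply/forall_inP=> u uT; apply/forall_inP=> v vT.
  by rewrite (eq_connect adjC); have /forall_inP/(_ u uT)/forall_inP/(_ v vT) := con.
have cardC : #|C| = #|vert G|.
  suff: #|C| * 2 = #|vert G| * 2 by lia.
  rewrite -!sum_nat_const -(eq_bigr _ (fun e _ => card_ends e)).
  rewrite -[RHS](eq_bigr _ (fun v _ => degC v)).
  under eq_bigr do rewrite -sum1_card.
  rewrite (exchange_big_dep predT) //=; apply: eq_bigr => v _.
  by rewrite /deg_in -sum1_card; apply: eq_bigl => e; rewrite !inE.
have [|f fP] := @two_regular_coloring G C (fun=> false) degC conC.
  by rewrite addb_const cardC (negPf evenV).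
have k_gt1 : 1 < k by lia.
exists (fun v => inr (if f v then Ordinal k_gt1 else Ordinal (ltnW k_gt1), true)).
move=> b u v _ _ Euv; have: sadj C (fun=> false) false u v.
  have [|e [ee _ eC]] := @adjCE false u v; first by apply/adjP; exists b.
  by apply/sadjP; exists e; rewrite eC.
by move/fP; case: b (f u) (f v) {Euv} => -[] [].
Qed.

(** If [t > 0], there are no double edges and the degree is 2. If [t = 0], the degree is even,
    positive, at most 4 and not 2, so every edge is doubled; an even cycle would then be
    colourable. *)
Lemma uncolorable_cycle :
    (forall v, exists x y, x != y /\ [set z | adj E v z] = [set x; y]) ->
    maxdeg G != 2 ->
  t = 0 /\ doubled_brooks sigma.
Proof.
move=> nb2 D2; have [v0 _] : exists v : vert G, v \in setT.
  by apply/set0Pn; case/andP: conG.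
have [x0 [y0 [xy0 nv0]]] := nb2 v0.
have [t0|/uncolorable_single simp] := posnP t; last first.
  case/eqP: D2; rewrite -(uncolorable_nb v0).
  have inj : {in nb E v0 setT &, injective snd}.
    move=> [b v] [c w]; rewrite !inE /= !andbT => Eb Ec eqw; subst w.
    congr pair; case: b c Eb Ec => -[] // Et Ef.
      by have := simp _ _ Et; rewrite Ef.
    by have := simp _ _ Ef; rewrite Et.
  have <- : #|[set x0; y0]| = 2 by rewrite cards2 xy0.
  rewrite -(card_in_imset inj) -nv0.
  apply: eq_card => v; rewrite inE; apply/imsetP/adjP => [[[b w]]|[b Eb]].
    by rewrite !inE andbT /= => Eb ->; exists b.
  by exists (b, v); rewrite // !inE Eb.
have nbS u x y : [set z | adj E u z] = [set x; y] ->
    nb E u setT \subset setX setT [set x; y].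
  move=> nu; apply/subsetP=> -[b v]; rewrite !inE /= andbT => Eb.
  have /setP/(_ v) := nu; rewrite !inE => <-; by apply/adjP; exists b.
have card4 (x y : vert G) : x != y -> #|setX [set: bool] [set x; y]| = 4.
  by move=> xy; rewrite cardsX cardsT card_bool cards2 xy.
have D4 : maxdeg G = 4.
  have := subset_leq_card (nbS _ _ _ nv0); rewrite card4 // uncolorable_nb.
  have: 0 < #|nb E v0 setT|.
    have: adj E v0 x0 by have /setP/(_ x0) := nv0; rewrite !inE eqxx.
    by case/adjP=> b Eb; apply/card_gt0P; exists (b, x0); rewrite !inE Eb.
  rewrite uncolorable_nb; move/eqP: D2; lia.
have dbl b u v : adj E u v -> E b u v.
  have [x [y [xy nu]]] := nb2 u.
  have eqnb : nb E u setT = setX setT [set x; y].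
    by apply/eqP; rewrite eqEcard nbS // card4 // uncolorable_nb D4.
  move=> uv; have: (b, v) \in setX [set: bool] [set x; y].
    by have /setP/(_ v) := nu; rewrite !inE uv => <-.
  by rewrite -eqnb !inE andbT.
split=> //; apply: doubled_of_double => //.
  have: v0 |: [set x0; y0] \subset setT by apply: subsetT.
  move/subset_leq_card; rewrite cardsT cardsU1 cards2 xy0 -nv0 inE.
  by rewrite adj_irr.
right; split; first exact: double_cycle_colorable.
by move=> v; have [x [y [xy ->]]] := nb2 v; rewrite cards2 xy.
Qed.

Lemma uncolorable_cases :
    ~ (t = 0 /\ doubled_brooks sigma) ->
  (complete G /\ t = (chi G).-1 /\ (chi G).-1 = maxdeg G) \/
  (balanced sigma /\ complete G) \/
  (balanced sigma /\ circuit G /\ odd (glength G)) \/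
  (~~ balanced sigma /\ circuit G /\ ~~ odd (glength G) /\ t = 0) \/
  (~~ balanced sigma /\ circuit G /\ odd (glength G) /\ t = 2).
Proof.
move=> nd; have [D2|D2] := eqVneq (maxdeg G) 2.
  by right; right; apply: uncolorable_circuit.
have [adjT|nb2] := complete_or_cycle (@symactK t k) E_sym E_irr nb_le cutG uncolE.
  have := uncolorable_simple_complete adjT (uncolorable_complete adjT D2 nd).
  by case=> [?|?]; [left | right; left].
case: nd; apply: uncolorable_cycle => // v.
by have [x [y [xy nv _]]] := nb2 v; exists x, y.
Qed.

End Necessity.

(** * From palettes of size [maxdeg G] to the symset chromatic number *)

Lemma dvdz2_sub (m n : nat) : (2 %| (m%:Z - n%:Z)%R)%Z = (odd m == odd n).
Proof. lia. Qed.

Theorem theorem2p4 (G : mgraph) (sigma : edge G -> bool) (t : nat)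
    (G_connected : connected G) (t_le_chi : t <= chi G) :
  (~~ (2 %| ((maxdeg G)%:Z - t%:Z)%R)%Z ->
     chi_sym sigma t <= maxdeg G + 1)
  /\
  ((2 %| ((maxdeg G)%:Z - t%:Z)%R)%Z ->
     (chi_sym sigma t = maxdeg G + 2 \/ chi_sym sigma t <= maxdeg G)
     /\
     (~ (t = 0 /\ doubled_brooks sigma) ->
      (chi_sym sigma t = maxdeg G + 2 <->
        (complete G /\ t = (chi G).-1 /\ (chi G).-1 = maxdeg G) \/
        (balanced sigma /\ complete G) \/
        (balanced sigma /\ circuit G /\ odd (glength G)) \/
        (~~ balanced sigma /\ circuit G /\ ~~ odd (glength G) /\ t = 0) \/
        (~~ balanced sigma /\ circuit G /\ odd (glength G) /\ t = 2)))).
Proof.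
have le_tD := leq_trans t_le_chi (chi_maxdeg G).
have V_gt0 : 0 < #|vert G|.
  by case/andP: G_connected => /set0Pn[x _] _; apply/card_gt0P; exists x.
rewrite dvdz2_sub; split=> [odd_Dt|even_Dt].
  have [k tkD] : exists k, t + 2 * k = maxdeg G + 1.
    by exists ((maxdeg G + 1 - t)./2); lia.
  by rewrite -tkD; apply: chi_sym_le; apply: greedy_sym; lia.
(* A priori [t] is at most [maxdeg G + 1]; parity excludes this extreme value. *)
have [k tkD] : exists k, t + 2 * k = maxdeg G.
  by exists ((maxdeg G - t)./2); lia.
have [chi_col chi_uncol] := chi_sym_maxdeg sigma tkD.
split; first by have [/chi_col|/chi_uncol] := boolP (sym_colorable sigma t k); auto.
move=> nd; split=> [chiD|].
  apply: (uncolorable_cases G_connected tkD) => //.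
  by apply/negP=> /chi_col; rewrite chiD; lia.
(* This makes [(chi G).-1] strictly smaller than [chi G], so a palette of that many self-inverse
   colours fails. *)
have chi_gt0 : 0 < chi G.
  rewrite lt0n; apply/eqP=> chi0.
  have /chi_leP/colorableP[c _] : chi G <= 0 by rewrite chi0.
  by case/card_gt0P: V_gt0 => v _; case: (c v).
move=> cases; apply: chi_uncol.
case: cases => [[_ [t_chi chiD]]|[[bal comp]|circ_cases]].
- have k0 : k = 0 by lia.
  by rewrite k0; apply/negP=> /sym_colorable0; lia.
- exact: balanced_complete_uncolorable.
have circG : circuit G by case: circ_cases => [[_ []]|[[_ []]|[_ []]]].
have D2 := circuit_maxdeg circG; have balE := circuit_balanced sigma circG.
have [[t2 k0]|[t0 k1]] : t = 2 /\ k = 0 \/ t = 0 /\ k = 1 by lia.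
  rewrite t2 k0; apply: odd_circuit_uncolorable2 => //.
  by case: circ_cases => [[_ []]|[[_ [_ [_]]]|[_ [_ []]]]] //; rewrite t2.
rewrite t0 k1; apply: circuit_uncolorable0 => //.
rewrite addb_negb -(negbK (\big[_/_]_(_ in _) _)) -balE.
by case: circ_cases => [[-> [_ oddG]]|[[/negPf-> [_ [/negPf evenG _]]]|[_ [_ [_]]]]];
  rewrite ?t0 // -/(glength G) ?oddG ?evenG.
Qed.
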